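(* Let $\bar d=(d_j)_{j\ge 0}$ be integers with $d_0=1$ and $d_j\ge 2$ for $j\ge 1$, and let $\bar p=(p_j)_{j\ge 1}$ with $p_j\in(0,1]$. The $\mathrm{AMFC}_{\bar d,\bar p}$ Markov chain on $\mathbb{Z}_+$ is null recurrent if and only if $\prod_{j=1}^{+\infty}p_j=0$. Otherwise the chain is transient.
   Context: $\mathbb{Z}_+=\{0,1,2,\dots\}$. Put $q_j=d_0d_1\cdots d_j$ for $j\ge 0$. Every $n\in\mathbb{Z}_+$ has a unique expansion $n=\sum_{j\ge1}a_j(n)q_{j-1}$ with digits $a_j(n)\in\{0,\dots,d_j-1\}$, only finitely many nonzero. Put $\zeta_n=\min\{j\ge1: a_j(n)\ne d_j-1\}$. The $\mathrm{AMFC}_{\bar d,\bar p}$ chain is the time-homogeneous Markov chain on $\mathbb{Z}_+$ with transition probabilities $s(n,m)$ (from $n$ to $m$): $s(n,n+1)=\prod_{j=1}^{\zeta_n}p_j$; $s(n,n)=1-p_1$; if $\zeta_n\ge2$, for $1\le r\le\zeta_n-1$, $s\big(n,\,n-\sum_{j=1}^r(d_j-1)q_{j-1}\big)=(1-p_{r+1})\prod_{j=1}^rp_j$; and $s(n,m)=0$ otherwise. *)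

(* Defs.v *)
From HB Require Import structures.
From mathcomp Require Import all_boot all_order all_algebra.
From mathcomp Require Import all_classical all_reals all_analysis.

Set Implicit Arguments.
Unset Strict Implicit.
Unset Printing Implicit Defensive.
Import Order.TTheory GRing.Theory Num.Theory.
Import numFieldNormedType.Exports.

Local Open Scope classical_set_scope.
Local Open Scope ring_scope.

Section Digits.
Variable d : nat -> nat.

Definition q (j : nat) : nat := (\prod_(0 <= i < j.+1) d i)%N.

(* The digit a_j(n), for j >= 1; see [digit_ltn], [digit_expansion] and
   [digit_unique]. *)
Definition digit (j n : nat) : nat := ((n %/ q j.-1) %% d j)%N.

(* The minimum exists as soon as every d j (j >= 1) is at least 2, see [zetaP];
   the value 0 is a junk value. *)
Definition zeta (n : nat) : nat :=
  if pselect (exists j, (0 < j)%N && (digit j n != (d j).-1)) is left e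
  then ex_minn e else 0%N.

Hypothesis d0 : d 0 = 1%N.
Hypothesis d_ge2 : forall j, (1 <= j)%N -> (2 <= d j)%N.

Lemma q0 : q 0 = 1%N.
Proof. by rewrite /q big_nat1 d0. Qed.

Lemma qS j : q j.+1 = (q j * d j.+1)%N.
Proof. by rewrite /q big_nat_recr. Qed.

Lemma q_gtn j : (j < q j)%N.
Proof.
elim: j => [|j IH]; first by rewrite q0.
rewrite qS; apply: leq_trans (_ : (q j * 2 <= _)%N).
  by rewrite muln2 -addnn -addn1 leq_add// (leq_trans _ IH).
by rewrite leq_mul2l d_ge2// orbT.
Qed.

Lemma digit_ltn j n : (1 <= j)%N -> (digit j n < d j)%N.
Proof. by move=> j1; rewrite ltn_mod (leq_trans _ (d_ge2 j1)). Qed.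

Lemma digit_modq n k :
  (\sum_(1 <= j < k.+1) digit j n * q j.-1)%N = (n %% q k)%N.
Proof.
elim: k => [|k IH]; first by rewrite big_geq// q0 modn1.
rewrite big_nat_recr//= IH /digit /= qS.
have := divn_eq n (q k); set a := (n %/ q k)%N; set b := (n %% q k)%N => en.
have := divn_eq a (d k.+1) => ea; rewrite [in RHS]en [in RHS]ea.
rewrite mulnDl -mulnA [(d _ * q _)%N]mulnC -addnA modnMDl.
rewrite [RHS]modn_small 1?addnC//.
have qk : (0 < q k)%N by rewrite (leq_ltn_trans _ (q_gtn k)).
have := digit_ltn n (ltn0Sn k); rewrite /digit/= => dk.
apply: leq_trans (_ : ((a %% d k.+1).+1 * q k <= _)%N).
  by rewrite mulSn ltn_add2r ltn_mod.
by rewrite [leqRHS]mulnC leq_mul2r dk orbT.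
Qed.

Lemma digit_expansion n k : (n <= k)%N ->
  n = (\sum_(1 <= j < k.+1) digit j n * q j.-1)%N.
Proof. by move=> nk; rewrite digit_modq modn_small// (leq_ltn_trans nk (q_gtn k)). Qed.

Lemma digit_unique (a : nat -> nat) k :
  (forall j, (1 <= j)%N -> (a j < d j)%N) ->
  forall i, (1 <= i <= k)%N ->
  digit i (\sum_(1 <= j < k.+1) a j * q j.-1)%N = a i.
Proof.
move=> ad i /andP[i1 ik].
have lt l : (\sum_(1 <= j < l.+1) a j * q j.-1 < q l)%N.
  elim: l => [|l IH]; first by rewrite big_geq// q0.
  rewrite big_nat_recr//= qS.
  apply: leq_trans (_ : ((a l.+1).+1 * q l <= _)%N); first by rewrite mulSn ltn_add2r.
  by rewrite [leqRHS]mulnC leq_mul2r ad ?orbT.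
have q_gt0 l : (0 < q l)%N by rewrite (leq_ltn_trans _ (q_gtn l)).
have [m ->] : exists m, (\sum_(1 <= j < k.+1) a j * q j.-1 =
    m * q i + \sum_(1 <= j < i.+1) a j * q j.-1)%N.
  elim: k ik => [|k IH]; first by case: i i1.
  rewrite leq_eqVlt => /predU1P[->|ik]; first by exists 0%N.
  have [m em] := IH ik.
  have [c ec] : exists c, q k = (c * q i)%N.
    elim: k ik {IH em} => [|k IH]; first by case: (i) i1.
    rewrite ltnS leq_eqVlt => /predU1P[->|].
      by exists 1%N; rewrite mul1n.
    by move=> /IH[c ec]; exists (c * d k.+1)%N; rewrite qS ec mulnAC.
  by exists (m + a k.+1 * c)%N; rewrite big_nat_recr//= em ec mulnDl mulnA addnAC.
case: i i1 {ik} => // i _; rewrite /digit big_nat_recr//= qS.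
rewrite addnCA addnC [(q i * _)%N]mulnC mulnA -mulnDl addnC.
rewrite divnDMl// divn_small// add0n.
by rewrite modnMDl modn_small// ad.
Qed.

Lemma zetaP n : [/\ (1 <= zeta n)%N, digit (zeta n) n <> (d (zeta n)).-1 &
  forall j, (1 <= j < zeta n)%N -> digit j n = (d j).-1].
Proof.
rewrite /zeta; case: pselect => [e|[]].
  case: ex_minnP => m /andP[m0 /eqP dm] min_m; split=> // j /andP[j0 jm].
  apply/eqP; apply: contraLR jm => dj; rewrite -leqNgt min_m//.
  by rewrite dj j0.
exists n.+1; rewrite /digit/= divn_small ?q_gtn// mod0n.
by have := d_ge2 (ltn0Sn n); case: (d n.+1) => [|[]].
Qed.

End Digits.

(* The transition probabilities s(n, m).  For every n the targets of the moves
   below are pairwise distinct, so for every m at most one summand is nonzero.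
   The truncated subtraction is exact, because the digits a_1(n), ..., a_r(n)
   are maximal when r < zeta n. *)
Definition amfc {R : realType} (d : nat -> nat) (p : nat -> R) (n m : nat) : R :=
  (if m == n.+1 then \prod_(1 <= j < (zeta d n).+1) p j else 0)
  + (if m == n then 1 - p 1%N else 0)
  + \sum_(1 <= r < zeta d n |
          m == (n - \sum_(1 <= j < r.+1) (d j).-1 * q d j.-1)%N)
      (1 - p r.+1) * \prod_(1 <= j < r.+1) p j.

Section MarkovChain.
Context {disp : measure_display} {T : measurableType disp} {R : realType}.
Implicit Types (s : nat -> nat -> R) (X : nat -> {mfun T >-> nat}).

Local Open Scope ereal_scope.

(* X is, under Q, a time-homogeneous Markov chain with transition
   probabilities s: P(X_{n+1} = x_{n+1} | X_0 = x_0, ..., X_n = x_n) =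
   s(x_n, x_{n+1}), multiplied out so as to cover conditioning events of
   probability 0. *)
Definition markov_chain (Q : probability T R) X s : Prop :=
  forall (n : nat) (x : nat -> nat),
    Q [set w | forall i, (i <= n.+1)%N -> X i w = x i] =
    Q [set w | forall i, (i <= n)%N -> X i w = x i] * (s (x n) (x n.+1))%:E.

(* The usual family (P_x) of laws: under P_x the chain X starts from x. *)
Definition markov_family (P : nat -> probability T R) X s : Prop :=
  forall x, P x [set w | X 0%N w = x] = 1 /\ markov_chain (P x) X s.

(* First return time to x, with inf of the empty set equal to +oo *)
Definition return_time X (x : nat) (w : T) : \bar R :=
  ereal_inf [set (n%:R)%:E | n in [set n | (1 <= n)%N /\ X n w = x]].

Definition return_prob (P : nat -> probability T R) X (x : nat) : \bar R :=
  P x [set w | exists n, (1 <= n)%N /\ X n w = x].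

Definition null_recurrent_state (P : nat -> probability T R) X (x : nat) : Prop :=
  return_prob P X x = 1 /\ \int[P x]_w return_time X x w = +oo.

Definition transient_state (P : nat -> probability T R) X (x : nat) : Prop :=
  return_prob P X x < 1.

Definition null_recurrent (P : nat -> probability T R) X : Prop :=
  forall x, null_recurrent_state P X x.

Definition transient (P : nat -> probability T R) X : Prop :=
  forall x, transient_state P X x.

End MarkovChain.

(* The limit exists whenever the p j (j >= 1) lie in [0, 1], the partial
   products being then nonincreasing and nonnegative. *)
Definition infprod {R : realType} (p : nat -> R) : R :=
  limn (fun n => \prod_(1 <= j < n.+1) p j).

(* Main.v *)
(* Write [pi_k = p_1 ... p_k].  A jump by [q_r - 1] downwards is possible from
   [n] exactly when [q_r] divides [n + 1], so the transition operator is
   [S f n = f (n+1)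
            - sum_(q_r | n+1) (pi_r - pi_(r+1)) (f (n+1) - f (n+1-q_r))].
   Let [b_n y] be the probability of avoiding [x] at the times [1..n] from [y];
   it is computed by iterating [S], and [b_n x] is the tail of the return time.
   The function [h 0 = 0], [h n = 1 / pi_(k+1)] for [q_k <= n < q_(k+1)] is
   harmonic off [0].
   If [pi_k] tends to a positive limit, [h] is bounded; set to zero below
   [q_x > x] it remains subharmonic, hence bounds [b_n] from below: transience.
   If [pi_k] tends to [0], [h] tends to infinity and the maximum principle,
   applied to [lim b_n - e h], gives [b_n -> 0]: recurrence.  Summing [S b_n]
   over the block [[0, q_k)], where the sum over [r] telescopes, then yields
   [q_k <= lim_N sum_(n < N) b_n x], so the mean return time is infinite. *)
Require Import Defs.
From mathcomp Require Import all_boot all_order all_algebra.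
From mathcomp Require Import all_classical all_reals all_analysis.
From mathcomp Require Import measurable_realfun ring lra zify.
Import Order.TTheory GRing.Theory Num.Theory.
Import numFieldNormedType.Exports.
Local Open Scope classical_set_scope.
Local Open Scope ring_scope.

(** * Divisibility by [q] and carries *)

Section Digits.
Set Implicit Arguments.
Unset Strict Implicit.
Unset Printing Implicit Defensive.
Variable d : nat -> nat.
Hypothesis d0 : d 0%N = 1%N.
Hypothesis d_ge2 : forall j, (1 <= j)%N -> (2 <= d j)%N.

Lemma q_gt0 k : (0 < q d k)%N.
Proof. by rewrite (leq_ltn_trans _ (q_gtn d0 d_ge2 k)). Qed.

Lemma dvdn_q i j : (i <= j)%N -> (q d i %| q d j)%N.
Proof.
elim: j => [|j IH]; first by rewrite leqn0 => /eqP->.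
rewrite leq_eqVlt => /predU1P[->//|/IH h].
by rewrite qS dvdn_mulr.
Qed.

Lemma leq_q i j : (i <= j)%N -> (q d i <= q d j)%N.
Proof. by move=> ij; rewrite dvdn_leq ?q_gt0// dvdn_q. Qed.

Lemma ltn_q i j : (i < j)%N -> (2 * q d i <= q d j)%N.
Proof.
move=> ij; apply: leq_trans (leq_q ij).
by rewrite qS mulnC leq_mul2l d_ge2 ?orbT.
Qed.

Lemma sum_max_digits r :
  (\sum_(1 <= j < r.+1) (d j).-1 * q d j.-1 = (q d r).-1)%N.
Proof.
elim: r => [|r IH]; first by rewrite big_geq// q0.
rewrite big_nat_recr//= IH qS.
have := q_gt0 r; have := d_ge2 (ltn0Sn r).
case: (d r.+1) => // e _; case: (q d r) => // k _ /=; nia.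
Qed.

(** Both sides say that the [r] lowest digits of [n] are maximal, that is, that [n] is [(q d r).-1]
    modulo [q d r]. This trades [zeta] for divisibility. *)
Lemma dvdn_q_zeta n r : (q d r %| n.+1)%N = (r < zeta d n)%N.
Proof.
have [z1 zd zmax] := zetaP d0 d_ge2 n.
apply/idP/idP => [qn|rz].
  rewrite ltnNge; apply/negP => zr; apply: zd.
  have := dvdn_trans (dvdn_q zr) qn; rewrite /digit.
  case: (zeta d n) z1 {zmax zr} => // z _; rewrite qS/= => /dvdnP[c ec].
  have dz := d_ge2 (ltn0Sn z); have qz := q_gt0 z.
  case: c ec => // c ec.
  (* Subtracting one from a multiple of [q d z.+1] makes digit [z.+1] of [n] maximal, against the
     choice of [zeta]. *)
  have -> : n = ((c * d z.+1 + (d z.+1).-1) * q d z + (q d z).-1)%N.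
    move: ec dz qz; case: (d z.+1) => // e; case: (q d z) => // k /=; nia.
  by rewrite divnMDl// [((q d z).-1 %/ _)%N]divn_small ?addn0 ?modnMDl
    ?modn_small// prednK// (leq_trans _ dz).
have : (n %% q d r)%N = (q d r).-1.
  rewrite -digit_modq// -sum_max_digits; apply: eq_big_nat => j /andP[j1 jr].
  by rewrite zmax// j1 (leq_trans jr).
move=> nq; rewrite (divn_eq n (q d r)) nq -addnS prednK ?q_gt0//.
by rewrite dvdn_add ?dvdn_mull.
Qed.

Lemma zeta_gt0 n : (0 < zeta d n)%N.
Proof. by have [] := zetaP d0 d_ge2 n. Qed.

Lemma zeta_le n : (zeta d n <= n.+1)%N.
Proof.
have /prednK <- := zeta_gt0 n; rewrite ltnS.
have : ((zeta d n).-1 < zeta d n)%N by rewrite prednK ?zeta_gt0.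
rewrite -dvdn_q_zeta => /(dvdn_leq (ltn0Sn n)).
by move=> /(leq_trans (q_gtn d0 d_ge2 _)).
Qed.

Lemma q_leS n r : (r < zeta d n)%N -> (q d r <= n.+1)%N.
Proof. by rewrite -dvdn_q_zeta => /(dvdn_leq (ltn0Sn n)). Qed.

End Digits.

(** * The transition operator *)

Section Step.
Set Implicit Arguments.
Unset Strict Implicit.
Unset Printing Implicit Defensive.
Variables (R : realType) (d : nat -> nat) (p : nat -> R).
Hypothesis d0 : d 0%N = 1%N.
Hypothesis d_ge2 : forall j, (1 <= j)%N -> (2 <= d j)%N.
Hypothesis p01 : forall j, (1 <= j)%N -> 0 < p j <= 1.
Implicit Types (f g : nat -> R) (n m k r : nat).

Definition pprod k : R := \prod_(1 <= j < k.+1) p j.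

(** For [r < zeta d n], the probability of the move from [n] to [n.+1 - q d r]; the case [r = 0] is
    that of staying put, as [q d 0 = 1]. *)
Definition pgap r : R := pprod r - pprod r.+1.

(** The truncation loses nothing, since the chain climbs by at most one ([amfc_eq0]). *)
Definition step f n : R := \sum_(m < n.+2) amfc d p n m * f m.

Lemma pprod0 : pprod 0 = 1. Proof. by rewrite /pprod big_geq. Qed.

Lemma pprodS k : pprod k.+1 = pprod k * p k.+1.
Proof. by rewrite /pprod big_nat_recr. Qed.

Lemma pprod_gt0 k : 0 < pprod k.
Proof.
by rewrite /pprod big_nat prodr_gt0// => j /andP[/p01/andP[]].
Qed.

Lemma pgapE r : pgap r = (1 - p r.+1) * pprod r.
Proof. by rewrite /pgap pprodS; ring. Qed.

Lemma pgap_ge0 r : 0 <= pgap r.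
Proof.
rewrite pgapE mulr_ge0 ?(ltW (pprod_gt0 r))//.
by have /andP[] := p01 (ltn0Sn r); lra.
Qed.

Lemma sum_pgap k : \sum_(0 <= r < k) pgap r = 1 - pprod k.
Proof.
rewrite (@telescope_sumr_eq _ _ _ (fun r => - pprod r))//.
  by rewrite pprod0; ring.
by move=> r _; rewrite /pgap; ring.
Qed.

Lemma amfc_ge0 n m : 0 <= amfc d p n m.
Proof.
rewrite /amfc !addr_ge0//.
- by case: ifP => // _; exact/ltW/pprod_gt0.
- by case: ifP => // _; have /andP[] := p01 (ltnSn 0); lra.
- by apply: sumr_ge0 => r _; rewrite -[X in 0 <= X]pgapE pgap_ge0.
Qed.

Lemma amfc_succ_gt0 n : 0 < amfc d p n n.+1.
Proof.
rewrite /amfc eqxx -addrA ltr_wpDr//; last exact: pprod_gt0.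
rewrite addr_ge0//.
- by case: ifP => // _; have /andP[] := p01 (ltnSn 0); lra.
- by apply: sumr_ge0 => r _; rewrite -[X in 0 <= X]pgapE pgap_ge0.
Qed.

Lemma amfc_eq0 n m : (n.+1 < m)%N -> amfc d p n m = 0.
Proof.
move=> nm; rewrite /amfc gtn_eqF// gtn_eqF 1?ltnW// !add0r.
rewrite big1// => r /eqP e; move: nm; rewrite e => h.
by rewrite ltnNge (leq_trans (leq_subr _ _)) in h.
Qed.

Lemma step_ge0 f n : (forall m, 0 <= f m) -> 0 <= step f n.
Proof. by move=> f0; apply: sumr_ge0 => m _; rewrite mulr_ge0 ?amfc_ge0. Qed.

Lemma step_succ_le f n : (forall m, 0 <= f m) ->
  amfc d p n n.+1 * f n.+1 <= step f n.
Proof.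
move=> f0; rewrite /step big_ord_recr/= lerDr.
by apply: sumr_ge0 => m _; rewrite mulr_ge0 ?amfc_ge0.
Qed.

Lemma stepB f g n : step (fun m => f m - g m) n = step f n - step g n.
Proof. by rewrite /step -sumrB; apply: eq_bigr => m _; rewrite mulrBr. Qed.

Lemma stepZ (c : R) f n : step (fun m => c * f m) n = c * step f n.
Proof. by rewrite /step mulr_sumr; apply: eq_bigr => m _; rewrite mulrCA. Qed.

Lemma le_step f g n : (forall m, f m <= g m) -> step f n <= step g n.
Proof.
move=> fg; rewrite -subr_ge0 -stepB; apply: step_ge0 => m.
by rewrite subr_ge0.
Qed.

Lemma step_zeta f n : step f n =
  pprod (zeta d n) * f n.+1 +
  \sum_(0 <= r < zeta d n) pgap r * f (n.+1 - q d r)%N.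
Proof.
have delta (c : R) k : (k < n.+2)%N ->
    \sum_(m < n.+2) (if val m == k then c else 0) * f m = c * f k.
  move=> kn; rewrite (bigD1 (Ordinal kn))//= eqxx big1 ?addr0// => m mk.
  by rewrite -val_eqE/= in mk; rewrite (negbTE mk) mul0r.
rewrite /step /amfc.
under [LHS]eq_bigr do rewrite 2!mulrDl.
rewrite !big_split/= delta// delta// -addrA; congr (_ + _).
rewrite [RHS](@big_ltn _ _ _ 0)//; last exact: zeta_gt0.
rewrite pgapE q0// subn1/= pprod0 mulr1; congr (_ + _).
under [LHS]eq_bigr do rewrite mulr_suml big_mkcond/=.
rewrite exchange_big/= [LHS]big_nat [RHS]big_nat.
apply: eq_bigr => r /andP[r1 rz].
rewrite sum_max_digits//.
have -> : (n - (q d r).-1 = n.+1 - q d r)%N.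
  by rewrite -(prednK (q_gt0 d0 d_ge2 r)) subSS.
rewrite pgapE -delta; last by rewrite (leq_ltn_trans (leq_subr _ _)).
by apply: eq_bigr => m _; case: ifP; rewrite ?mul0r.
Qed.

(** The weights in [step_zeta] add up to one, so [f n.+1] can be taken out; the terms beyond [zeta]
    fail the divisibility test. *)
Lemma stepE f n : step f n =
  f n.+1 - \sum_(0 <= r < n.+1 | (q d r %| n.+1)%N)
             pgap r * (f n.+1 - f (n.+1 - q d r)%N).
Proof.
rewrite step_zeta [X in _ = _ - X]big_mkcond/=.
rewrite (big_cat_nat _ (zeta_le d0 d_ge2 n))//=.
rewrite [X in _ - (_ + X)]big_nat_cond [X in _ - (_ + X)]big1 ?addr0;
  last first.
  by move=> r /andP[/andP[zr _] _]; rewrite dvdn_q_zeta// ltnNge zr.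
rewrite [X in _ - X](_ : _ = \sum_(0 <= r < zeta d n) pgap r * f n.+1 -
    \sum_(0 <= r < zeta d n) pgap r * f (n.+1 - q d r)%N).
  by rewrite -mulr_suml sum_pgap; ring.
rewrite -sumrB; apply: eq_big_nat => r /andP[_ rz].
by rewrite dvdn_q_zeta// rz mulrBr.
Qed.

Lemma step_cst (c : R) n : step (fun=> c) n = c.
Proof. by rewrite stepE big1 ?subr0// => r _; rewrite subrr mulr0. Qed.

(* Above [q k] the chain can only enter [[0, q k)] through [0]. *)
Lemma step_upper_ge0 f n k : (q d k <= n)%N -> 0 <= f 0%N ->
  (forall m, (q d k <= m)%N -> 0 <= f m) -> 0 <= step f n.
Proof.
move=> kn f0 fk; rewrite step_zeta addr_ge0//.
  by rewrite mulr_ge0 ?(ltW (pprod_gt0 _))// fk// (leq_trans kn).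
rewrite big_nat sumr_ge0// => r /andP[_ rz]; rewrite mulr_ge0 ?pgap_ge0//.
have [e|/eqP ne] := eqVneq (n.+1 - q d r)%N 0%N; first by rewrite e.
apply: fk.
have := rz; rewrite -dvdn_q_zeta// => /dvdnP[c ec].
(* If [r <= k], then [q d k] is a multiple of [q d r] smaller than [n.+1], so one jump cannot pass
   below it. Otherwise a nonzero multiple of [q d r] is already at least [q d k]. *)
have [rk|kr] := leqP r k.
  have /dvdnP[e ee] := dvdn_q d rk.
  have ec' : (e < c)%N by rewrite -(ltn_pmul2r (q_gt0 d0 d_ge2 r)) -ee -ec.
  by rewrite ec ee -[X in (_ - X)%N]mul1n -mulnBl leq_mul2r; lia.
apply: leq_trans (leq_q d0 d_ge2 (ltnW kr)) _.
move: ne; rewrite ec -[X in (_ - X)%N]mul1n -mulnBl.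
by case: (c - 1)%N => [|e _]; [rewrite mul0n | rewrite leq_pmull].
Qed.

Lemma step_upper_eq f g n k : (q d k <= n)%N -> f 0%N = g 0%N ->
  (forall m, (q d k <= m)%N -> f m = g m) -> step f n = step g n.
Proof.
move=> kn f0 fk; apply/eqP; rewrite eq_le; apply/andP; split;
  rewrite -subr_ge0 -stepB;
  by apply: (step_upper_ge0 kn); rewrite ?f0 ?subrr// => m mk;
  rewrite fk// subrr.
Qed.

(* The contributions of the jumps of size [q r] telescope over the block. *)
Lemma step_block f k : \sum_(0 <= n < q d k) step f n =
  \sum_(0 <= n < q d k) f n + pprod k.+1 * (f (q d k) - f 0%N).
Proof.
under eq_bigr do rewrite stepE.
rewrite sumrB.
have -> : \sum_(0 <= n < q d k) f n.+1 =
    \sum_(0 <= n < q d k) f n + (f (q d k) - f 0%N).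
  rewrite -(@telescope_sumr_eq _ _ _ f (fun n => f n.+1 - f n))//.
  by rewrite -big_split/=; apply: eq_bigr => n _; rewrite addrC subrK.
suff -> : \sum_(0 <= n < q d k) \sum_(0 <= r < n.+1 | (q d r %| n.+1)%N)
    pgap r * (f n.+1 - f (n.+1 - q d r)%N) =
    \sum_(0 <= r < k.+1) pgap r * (f (q d k) - f 0%N).
  by rewrite -mulr_suml sum_pgap; ring.
transitivity (\sum_(0 <= n < q d k) \sum_(0 <= r < k.+1)
    if (q d r %| n.+1)%N then pgap r * (f n.+1 - f (n.+1 - q d r)%N) else 0).
  apply: eq_big_nat => n /andP[_ nk]; rewrite big_mkcond/=.
  (* Only [r < zeta d n] contribute, and both [n.+1] and [k.+1] bound [zeta d n]: inside the block,
     [n.+1 <= q d k < q d k.+1]. *)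
  have trim a b c : (a <= b)%N -> (a <= c)%N ->
      (forall r, (a <= r)%N -> ~~ (q d r %| n.+1)%N) ->
      \sum_(0 <= r < b) (if (q d r %| n.+1)%N then
         pgap r * (f n.+1 - f (n.+1 - q d r)%N) else 0) =
      \sum_(0 <= r < c) (if (q d r %| n.+1)%N then
         pgap r * (f n.+1 - f (n.+1 - q d r)%N) else 0).
    move=> ab ac az; rewrite (big_cat_nat _ ab)//= (big_cat_nat _ ac)//=.
    congr (_ + _); rewrite !big_nat !big1// => r /andP[ar _].
      by rewrite (negbTE (az r ar)).
    by rewrite (negbTE (az r ar)).
  apply: (trim (zeta d n)); first exact: zeta_le.
    rewrite leqNgt; apply/negP => /(q_leS d0 d_ge2) h.
    have := leq_trans (ltn_q d0 d_ge2 (ltnSn k)) (leq_trans h nk).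
    by have := q_gt0 d0 d_ge2 k; lia.
  by move=> r zr; rewrite dvdn_q_zeta// -leqNgt.
rewrite exchange_big/=; apply: eq_big_nat => r /andP[_ rk].
have /dvdnP[c ec] := dvdn_q d (rk : (r <= k)%N).
rewrite ec.
(* Cut [[0, q_k)] into [c] intervals of length [q_r]; in each, only the last [n] allows the jump,
   and it spans the interval. *)
elim: c {ec rk} => [|c IH]; first by rewrite mul0n big_geq// subrr mulr0.
rewrite mulSnr.
rewrite (big_cat_nat (n := (c * q d r)%N)) ?leq_addr//= IH.
have -> : \sum_(c * q d r <= n < c * q d r + q d r)
    (if (q d r %| n.+1)%N then pgap r * (f n.+1 - f (n.+1 - q d r)%N) else 0) =
    pgap r * (f (c * q d r + q d r)%N - f (c * q d r)%N).
  have q0' := q_gt0 d0 d_ge2 r.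
  have -> : (c * q d r + q d r = (c * q d r + (q d r).-1).+1)%N.
    by rewrite -addnS prednK.
  rewrite big_nat_recr ?leq_addr//= -addnS prednK// dvdn_add ?dvdn_mull//.
  rewrite addnK big_nat big1 ?add0r// => n /andP[h1 h2].
  case: ifP => // /dvdnP[e ee]; exfalso.
  have ce : (c < e)%N by rewrite -(ltn_pmul2r q0') -ee ltnS.
  have : (e < c.+1)%N.
    rewrite -(ltn_pmul2r q0') -ee mulSnr -(prednK q0') addnS ltnS.
    by rewrite prednK.
  by rewrite ltnNge ce.
ring.
Qed.

End Step.

(** * Partial products and the harmonic function *)

Section Avoid.
Set Implicit Arguments.
Unset Strict Implicit.
Unset Printing Implicit Defensive.
Variables (R : realType) (d : nat -> nat) (p : nat -> R).
Hypothesis d0 : d 0%N = 1%N.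
Hypothesis d_ge2 : forall j, (1 <= j)%N -> (2 <= d j)%N.
Hypothesis p01 : forall j, (1 <= j)%N -> 0 < p j <= 1.
Implicit Types (f g : nat -> R) (n m k r x y : nat).

Local Notation pprod := (pprod p).
Local Notation pgap := (pgap p).
Local Notation step := (step d p).

Lemma pprod_homo k l : (k <= l)%N -> pprod l <= pprod k.
Proof.
elim: l => [|l IH]; first by rewrite leqn0 => /eqP->.
rewrite leq_eqVlt => /predU1P[->//|kl]; apply: le_trans (IH kl).
rewrite pprodS ler_piMr ?(ltW (pprod_gt0 p01 l))//.
by have /andP[] := p01 (ltn0Sn l).
Qed.

Lemma cvg_pprod : pprod @ \oo --> infprod p.
Proof.
apply: nonincreasing_is_cvgn; first by move=> k l /pprod_homo.
by exists 0 => _ [k _ <-]; exact/ltW/(pprod_gt0 p01).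
Qed.

Lemma infprod_le k : infprod p <= pprod k.
Proof.
apply: (@nonincreasing_cvgn_ge _ pprod); first by move=> i j /pprod_homo.
exact: cvgP cvg_pprod.
Qed.

Lemma infprod_ge0 : 0 <= infprod p.
Proof.
apply: limr_ge; first exact: cvgP cvg_pprod.
by near=> k; exact/ltW/(pprod_gt0 p01).
Unshelve. all: by end_near. Qed.

Lemma exists_ltn_q m : exists k, (m < q d k)%N.
Proof. by exists m; exact: q_gtn. Qed.

Definition harm m : R :=
  if m == 0%N then 0 else (pprod (ex_minn (exists_ltn_q m)))^-1.

Lemma harm0 : harm 0 = 0. Proof. by []. Qed.

Lemma q_bracket m : (0 < m)%N -> exists k, (q d k <= m < q d k.+1)%N.
Proof.
move=> m0; have := exists_ltn_q m => e.
case: (ex_minnP e) => -[|k]; first by rewrite q0// ltnNge m0.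
move=> mk min; exists k; rewrite mk andbT leqNgt; apply/negP => /min.
by rewrite ltnn.
Qed.

Lemma harmE k m : (q d k <= m < q d k.+1)%N -> harm m = (pprod k.+1)^-1.
Proof.
move=> /andP[km mk]; rewrite /harm gtn_eqF ?(leq_trans (q_gt0 d0 d_ge2 k))//.
case: ex_minnP => l ml min; congr (pprod _)^-1.
apply/eqP; rewrite eqn_leq min//= ltnNge; apply/negP => lk.
have := leq_q d0 d_ge2 lk.
by rewrite leqNgt (leq_ltn_trans km).
Qed.

Lemma harm_ge0 m : 0 <= harm m.
Proof.
by rewrite /harm; case: ifP => // _; rewrite invr_ge0 ltW ?(pprod_gt0 p01).
Qed.

Lemma harm_ge k m : (q d k <= m)%N -> (pprod k.+1)^-1 <= harm m.
Proof.
move=> km; have /q_bracket[l /[dup] lm /harmE->] : (0 < m)%N.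
  exact: leq_trans (q_gt0 d0 d_ge2 k) km.
rewrite lef_pV2 ?posrE ?(pprod_gt0 p01)// pprod_homo// ltnS.
rewrite leqNgt; apply/negP => lk.
have /andP[_] := lm; rewrite ltnNge.
by rewrite (leq_trans (leq_q d0 d_ge2 lk)).
Qed.

(** If [n.+1] stays in the block of [n], all moves do too, and [harm] is constant there. If
    [n.+1 = q d k.+1], the jump to [0] costs what the rise to [1 / pi_(k+2)] gains: [1 + (1 -
    pi_(k+1)) / pi_(k+1) = 1 / pi_(k+1)]. *)
Lemma step_harm n : (0 < n)%N -> step harm n = harm n.
Proof.
move=> /q_bracket[k /[dup] /harmE -> /andP[kn nk]].
have p0 j : pprod j != 0 by rewrite gt_eqF ?(pprod_gt0 p01).
move: nk; rewrite leq_eqVlt => /predU1P[nk|nk].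
  have z : zeta d n = k.+2.
    apply/eqP; rewrite eqn_leq -[X in _ && X]dvdn_q_zeta// nk dvdnn andbT.
    rewrite leqNgt -dvdn_q_zeta// nk; apply/negP => /dvdn_leq.
    have := ltn_q d0 d_ge2 (ltnSn k.+1); have := q_gt0 d0 d_ge2 k.+1; lia.
  rewrite step_zeta// z nk big_nat_recr//= subnn harm0 mulr0 addr0.
  rewrite (@harmE k.+1); last first.
    rewrite leqnn/= (leq_trans _ (ltn_q d0 d_ge2 (ltnSn _)))//.
    by have := q_gt0 d0 d_ge2 k.+1; lia.
  rewrite (eq_big_nat _ _ (F2 := fun r => pgap r * (pprod k.+1)^-1)).
    by rewrite -mulr_suml sum_pgap; field; rewrite !p0.
  move=> r /andP[_ rk]; rewrite (@harmE k)//.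
  have := q_gt0 d0 d_ge2 r.
  have := ltn_q d0 d_ge2 (ltnSn k); have := @leq_q _ d0 d_ge2 r k rk; lia.
rewrite stepE// (@harmE k) ?nk ?(leq_trans kn)// big_nat_cond big1 ?subr0//.
move=> r /andP[_ rn]; rewrite (@harmE k) ?subrr ?mulr0//.
have qr := dvdn_leq (ltn0Sn n) rn.
have rk : (r <= k)%N.
  rewrite leqNgt; apply/negP => /(leq_q d0 d_ge2).
  by rewrite leqNgt (leq_ltn_trans qr).
apply/andP; split; last exact: leq_ltn_trans (leq_subr _ _) nk.
move: rn => /dvdnP[c ec]; have /dvdnP[e ee] := dvdn_q d rk.
have ce : (e < c)%N by rewrite -(ltn_pmul2r (q_gt0 d0 d_ge2 r)) -ee -ec.
by rewrite ec ee -[X in (_ - X)%N]mul1n -mulnBl leq_mul2r; lia.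
Qed.

(** * Avoidance probabilities and their limits *)

Definition taboo x f y : R := if y == x then 0 else f y.

(* The probability, starting from [y], to avoid [x] at the times 1, ..., n. *)
Fixpoint avoid x n : nat -> R :=
  if n is n'.+1 then step (taboo x (avoid x n')) else fun=> 1.

Lemma taboo_ge0 x f : (forall y, 0 <= f y) -> forall y, 0 <= taboo x f y.
Proof. by move=> f0 y; rewrite /taboo; case: ifP. Qed.

Lemma avoid_ge0 x n y : 0 <= avoid x n y.
Proof.
elim: n y => [|n IH] y //=; apply: step_ge0 => //.
exact: taboo_ge0.
Qed.

Lemma avoidS_le x n y : avoid x n.+1 y <= avoid x n y.
Proof.
elim: n y => [|n IH] y.
  rewrite -[leRHS](step_cst p d0 d_ge2 1 y); apply: le_step => // m.
  by rewrite /taboo; case: ifP.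
apply: le_step => // m; rewrite /taboo; case: ifP => // _; exact: IH.
Qed.

Lemma avoid_homo x y : nonincreasing_seq (avoid x ^~ y).
Proof. by apply/nonincreasing_seqP => n; exact: avoidS_le. Qed.

Lemma avoid_gt0_lb x : 0 < infprod p ->
  exists2 c, 0 < c & forall n, c <= avoid x n x.
Proof.
move=> L0; pose h m := if (q d x <= m)%N then harm m else 0.
(* The factor [infprod p] brings [h] below one, which starts the induction; the taboo costs nothing
   because [h x = 0]. *)
have low n y : infprod p * h y <= avoid x n y.
  elim: n y => [|n IH] y.
    rewrite /h; case: ifP => [xy|]; last by rewrite mulr0 ler01.
    have /q_bracket[k /harmE->] : (0 < y)%N.
      exact: leq_trans (q_gt0 d0 d_ge2 x) xy.
    by rewrite /= ler_pdivrMr ?(pprod_gt0 p01)// mul1r infprod_le.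
  have [xy|yx] := leqP (q d x) y; last first.
    by rewrite /h leqNgt yx/= mulr0 (avoid_ge0 _ n.+1).
  rewrite /h xy -step_harm ?(leq_trans _ xy) ?q_gt0//.
  rewrite (@step_upper_eq _ _ _ d0 d_ge2 p01 _ h y x)//.
  - rewrite -stepZ; apply: le_step => // m; rewrite /taboo.
    case: eqP => [->|_]; last exact: IH.
    by rewrite /h leqNgt q_gtn// mulr0.
  - by rewrite /h leqn0 gtn_eqF// q_gt0.
  - by move=> m; rewrite /h => ->.
(* From [x] the chain climbs to [q d x] by unit steps of positive probability, never meeting [x]
   again; the bound is carried down along this path. *)
suff desc i : (i <= q d x - x)%N ->
    exists2 c, 0 < c & forall n, c <= avoid x n (q d x - i)%N.
  have := desc _ (leqnn _).
  by rewrite subKn// ltnW// q_gtn.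
elim: i => [_|i IH ix].
  rewrite subn0; exists (infprod p * h (q d x)); last by move=> n; exact: low.
  rewrite mulr_gt0// /h leqnn (lt_le_trans _ (harm_ge (leqnn _)))//.
  by rewrite invr_gt0 (pprod_gt0 p01).
have [c c0 cn] := IH (ltnW ix).
set y := (q d x - i.+1)%N.
have ey : (q d x - i = y.+1)%N by rewrite /y; lia.
exists (amfc d p y y.+1 * c); first by rewrite mulr_gt0 ?amfc_succ_gt0.
move=> n; apply: le_trans (avoidS_le _ _ _).
apply: le_trans (step_succ_le d p01 _ _); last first.
  by apply: taboo_ge0; exact: avoid_ge0.
rewrite /taboo ifN; last by rewrite -ey; lia.
by rewrite ler_pM2l ?amfc_succ_gt0// -ey cn.
Qed.

(** An average that equals an upper bound is attained at every point of positive weight, and the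
    successor always has one. *)
Lemma step_max f y (M : R) : (forall m, f m <= M) -> step f y = M ->
  f y.+1 = M.
Proof.
move=> fM sM; apply/eqP; rewrite eq_le fM/= -subr_le0.
rewrite -(pmulr_rle0 _ (amfc_succ_gt0 d p01 y)).
have := @step_succ_le R d p p01 (fun m => M - f m) y.
rewrite stepB step_cst// sM subrr; apply => m.
by rewrite subr_ge0.
Qed.

Lemma cvg_step (u : nat -> nat -> R) f y :
  (forall m, u ^~ m @ \oo --> f m) ->
  (fun n => step (u n) y) @ \oo --> step f y.
Proof.
move=> uf; apply: cvg_big => [|m _]; first exact: add_continuous.
by apply: cvgMl_tmp; exact: uf.
Qed.

(* By the maximum principle the bounded function [f], harmonic off [x] and zero
   at [x], is maximal at [0]: otherwise [f - e * harm] would have a maximum that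
   propagates from [y] to [y.+1], up to [x] or to infinity.  A maximum at [0] in
   turn propagates up to [x]. *)
Lemma harmonic_off_eq0 x f : infprod p = 0 -> f x = 0 ->
  (forall y, 0 <= f y <= 1) -> (forall y, y != x -> step f y = f y) ->
  forall y, f y = 0.
Proof.
move=> L0 fx f01 fH.
have f_ge0 y : 0 <= f y by have /andP[] := f01 y.
have f_le0 y : f y <= f 0%N.
  apply/ler_addgt0Pl => e0 e0_gt0.
  (* This makes [e * harm y <= e0]; the added one keeps the denominator positive when
     [harm y = 0]. *)
  pose e := e0 / (1 + harm y).
  have hy := harm_ge0 y.
  have e_gt0 : 0 < e by rewrite divr_gt0//; lra.
  pose D m := f m - e * harm m.
  suff : D y <= f 0%N.
    rewrite /D lerBlDr => /le_trans; apply; rewrite addrC lerD2r.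
    by rewrite /e mulrAC ler_pdivrMr ?ler_pM2l//; lra.
  rewrite leNgt; apply/negP => Dy.
  have [K piK] : exists K, pprod K < e.
    have /cvgrPdist_lt/(_ e e_gt0)[K _ hK] := cvg_pprod.
    exists K; have := hK K (leqnn K).
    by rewrite L0 sub0r normrN gtr0_norm// (pprod_gt0 p01).
  have Dneg m : (q d K <= m)%N -> D m < 0.
    move=> Km; have /andP[_ f1] := f01 m; rewrite /D subr_lt0.
    apply: le_lt_trans f1 _; rewrite mulrC -ltr_pdivrMr// mul1r.
    apply: lt_le_trans (harm_ge Km).
    rewrite ltf_pV2 ?posrE ?(pprod_gt0 p01)//.
    by rewrite (le_lt_trans _ piK)// pprod_homo.
  pose N := (q d K + y.+1)%N.
  have yN : (y < N)%N by rewrite /N addnS ltnS leq_addl.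
  case: (@arg_maxP _ _ _ (Ordinal yN) xpredT (fun i : 'I_N => D i) isT).
  move=> i _ iM.
  have Di : f 0%N < D i by exact: lt_le_trans Dy (iM (Ordinal yN) isT).
  have Di0 : 0 < D i by rewrite (le_lt_trans _ Di).
  have DM m : D m <= D i.
    have [mN|Nm] := ltnP m N; first exact: (iM (Ordinal mN) isT).
    apply: le_trans (ltW Di0); apply/ltW/Dneg.
    by rewrite (leq_trans _ Nm)// leq_addr.
  have i0 : (0 < i)%N.
    rewrite lt0n; apply/eqP => ie; move: Di.
    by rewrite ie /D harm0 mulr0 subr0 ltxx.
  have Dj j : D (i + j)%N = D i.
    elim: j => [|j IH]; first by rewrite addn0.
    rewrite addnS; apply: step_max DM _.
    rewrite /D stepB stepZ step_harm ?addn_gt0 ?i0// fH//.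
    apply/eqP => ijx; move: Di0; rewrite -IH /D ijx fx sub0r.
    by rewrite oppr_gt0 ltNge mulr_ge0 ?harm_ge0 ?ltW.
  by have := Dneg _ (leq_addl i (q d K)); rewrite Dj ltNge ltW.
suff f00 : f 0%N = 0.
  by move=> y; apply/eqP; rewrite eq_le -{1}f00 f_le0 f_ge0.
have fj j : (j <= x)%N -> f j = f 0%N.
  elim: j => // j IH jx; apply: step_max f_le0 _.
  by rewrite fH ?IH 1?ltnW// neq_ltn jx.
by rewrite -(fj x).
Qed.

(** The monotone limit [a] satisfies [step (taboo x a) = a], so [taboo x a] is harmonic off [x] and
    vanishes; one more [step] gives [a = 0], at [x] included. *)
Lemma cvg_avoid x y : infprod p = 0 -> avoid x ^~ y @ \oo --> 0.
Proof.
move=> L0; pose a y := limn (avoid x ^~ y).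
have avoid_cvg z : avoid x ^~ z @ \oo --> a z.
  apply: nonincreasing_is_cvgn; first exact: avoid_homo.
  by exists 0 => _ [k _ <-]; exact: avoid_ge0.
have step_a z : step (taboo x a) z = a z.
  have h : (fun n => step (taboo x (avoid x n)) z) @ \oo --> step (taboo x a) z.
    apply: cvg_step => m; rewrite /taboo; case: eqP => _; last exact: avoid_cvg.
    exact: cvg_cst.
  apply/esym; apply: cvg_unique h => //.
  by have := avoid_cvg z; rewrite -cvg_shiftS.
have ta z : taboo x a z = 0.
  apply: (@harmonic_off_eq0 x) => //.
  - by rewrite /taboo eqxx.
  - move=> m; rewrite /taboo; case: ifP => _; first by rewrite lexx ler01.
    apply/andP; split.
      apply: limr_ge; first exact: cvgP (avoid_cvg m).
      by apply: nearW => n; exact: avoid_ge0.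
    exact: (nonincreasing_cvgn_ge (avoid_homo x m) (cvgP _ (avoid_cvg m)) 0%N).
  - by move=> m mx; rewrite step_a /taboo (negbTE mx).
suff -> : 0 = a y by exact: avoid_cvg.
by rewrite -step_a; apply/esym/big1 => m _; rewrite ta mulr0.
Qed.

(* The chain started above [q k] visits [0] before [x]. *)
Lemma avoid_upper x n k y : (0 < x < q d k)%N -> (q d k <= y)%N ->
  avoid x n 0 <= avoid x n y.
Proof.
move=> /andP[x0 xk]; elim: n y => [|n IH] y ky //.
apply: le_trans (avoidS_le _ _ _) _; rewrite -subr_ge0 /=.
rewrite -[X in _ - X](step_cst p d0 d_ge2 _ y) -stepB.
apply: (step_upper_ge0 d0 d_ge2 p01 ky).
  by rewrite /taboo ifN ?subrr// neq_ltn x0.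
move=> m km; rewrite /taboo ifN ?subr_ge0 ?IH//.
by rewrite neq_ltn (leq_trans xk km) orbT.
Qed.

(** Equality holds at [N = 0], and the right side does not decrease with [N]: the taboo removes
    [avoid x N x] from the block sum, the second sum recovers it, and the boundary term of
    [step_block] is nonnegative. *)
Lemma sum_avoid_ge x k N : (x < q d k)%N ->
  (q d k)%:R <= \sum_(0 <= y < q d k) avoid x N y
                + \sum_(0 <= n < N) avoid x n x.
Proof.
move=> xk; elim: N => [|N IH].
  by rewrite [X in _ + X]big_geq// addr0 big_const_nat subn0 iter_addr_0.
rewrite big_nat_recr//= step_block//; apply: le_trans IH _.
have -> : \sum_(0 <= y < q d k) avoid x N y =
    \sum_(0 <= y < q d k) taboo x (avoid x N) y + avoid x N x.
  rewrite !big_mkord (bigD1 (Ordinal xk))//= [in RHS](bigD1 (Ordinal xk))//=.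
  rewrite [taboo x _ x]/taboo eqxx add0r addrC; congr (_ + _).
  apply: eq_bigr => i; rewrite -val_eqE/= => ix.
  by rewrite /taboo (negbTE ix).
suff : 0 <= pprod k.+1 * (taboo x (avoid x N) (q d k) - taboo x (avoid x N) 0).
  by lra.
rewrite mulr_ge0 ?(ltW (pprod_gt0 p01 _))// subr_ge0.
(* For [x = 0] the taboo value at [0] is zero; otherwise [avoid_upper] compares the two ends. *)
have [->|x0] := posnP x.
  by rewrite {1}/taboo eqxx taboo_ge0// => m; exact: avoid_ge0.
rewrite /taboo ifN ?ifN ?(@avoid_upper _ _ k) ?x0//.
  by rewrite neq_ltn xk orbT.
by rewrite neq_ltn x0.
Qed.

(** Fix a block of length at least [B + 1]: for large [N] its sum of [avoid x N] drops below one,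
    and [sum_avoid_ge] leaves [B] to the other sum. *)
Lemma sum_avoid_unbounded x (B : R) : infprod p = 0 ->
  exists N, B <= \sum_(0 <= n < N) avoid x n x.
Proof.
move=> L0; pose k := maxn x (Num.truncn (B + 1)).+1.
have xk : (x < q d k)%N.
  by rewrite (leq_ltn_trans _ (q_gtn d0 d_ge2 k))// leq_maxl.
have Bk : B + 1 <= (q d k)%:R.
  apply/ltW/(lt_le_trans (truncnS_gt _)); rewrite ler_nat.
  by rewrite (leq_trans (leq_maxr x _))// ltnW// q_gtn.
have : (fun N => \sum_(0 <= y < q d k) avoid x N y) @ \oo --> (0 : R).
  rewrite [X in _ --> X](_ : _ = \sum_(0 <= y < q d k) 0); last by rewrite big1.
  apply: cvg_big => [|y _]; first exact: add_continuous.
  exact: cvg_avoid.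
move=> /cvgrPdist_le/(_ 1 ltr01)[N _ /(_ N (leqnn N))] /=.
rewrite sub0r normrN => /(le_trans (ler_norm _)) h.
by exists N; have := sum_avoid_ge N xk; lra.
Qed.

End Avoid.

(** * Laws of path events *)

Section PathLaw.
Set Implicit Arguments.
Unset Strict Implicit.
Unset Printing Implicit Defensive.
Context {disp : measure_display} {T : measurableType disp} {R : realType}.
Variables (d : nat -> nat) (p : nat -> R).
Hypothesis d0 : d 0%N = 1%N.
Hypothesis d_ge2 : forall j, (1 <= j)%N -> (2 <= d j)%N.
Hypothesis p01 : forall j, (1 <= j)%N -> 0 < p j <= 1.
Variable X : nat -> {mfun T >-> nat}.

Local Open Scope ereal_scope.

Definition cylinder k (u : nat -> nat) : set T :=
  [set w | forall i, (i <= k)%N -> X i w = u i].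

(** The window opens after time [k], so that an induction can move its origin forward. *)
Definition avoiding x k n : set T :=
  [set w | forall i, (k < i <= k + n)%N -> X i w <> x].

Lemma measurable_X i (A : set nat) : measurable [set w | A (X i w)].
Proof. by rewrite -[X in measurable X]setTI; exact: measurable_funP. Qed.

Lemma measurable_cylinder k u : measurable (cylinder k u).
Proof.
rewrite (_ : cylinder k u = \bigcap_(i in `I_k.+1) [set w | X i w = u i]).
  by apply: fin_bigcap_measurable => // i _; exact: (measurable_X i [set u i]).
by apply/seteqP; split=> w /= h i ik; exact: h.
Qed.

Lemma measurable_avoiding x k n : measurable (avoiding x k n).
Proof.
rewrite (_ : avoiding x k n =
    \bigcap_(i in [set i | (k < i <= k + n)%N]) [set w | X i w <> x]).
  apply: bigcap_measurableType => // i _.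
  exact: (measurable_X i (~` [set x])).
by apply/seteqP; split=> w /= h i ik; exact: h.
Qed.

Lemma nneseries_finite (c : nat -> \bar R) N :
  (forall z, (N <= z)%N -> c z = 0) ->
  \sum_(0 <= z <oo) c z = \sum_(0 <= z < N) c z.
Proof.
move=> c0; apply: lim_near_cst => //; exists N => //= n Nn.
rewrite (big_cat_nat _ Nn)//= [X in _ + X]big_nat [X in _ + X]big1 ?adde0//.
by move=> z /andP[Nz _]; exact: c0.
Qed.

(** Induction on [n] over all histories [u]: condition on the value [z] at time [k.+1], which
    lengthens the history by one. *)
Lemma markov_avoiding (Q : probability T R) x n k u :
  markov_chain Q X (amfc d p) ->
  Q (cylinder k u `&` avoiding x k n) =
  Q (cylinder k u) * (avoid d p x n (u k))%:E.
Proof.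
move=> hQ; elim: n k u => [|n IH] k u /=.
  rewrite mule1; congr (Q _); apply/seteqP; split=> [w []//|w h]; split=> // i.
  by rewrite addn0 => /andP[ki]; rewrite leqNgt ki.
pose v z i := if i == k.+1 then z else u i.
pose F z := if z == x then set0 else
  cylinder k.+1 (v z) `&` avoiding x k.+1 n.
have vE z : v z k.+1 = z by rewrite /v eqxx.
have vk z i : (i <= k)%N -> v z i = u i.
  by move=> ik; rewrite /v ltn_eqF// ltnS.
have -> : cylinder k u `&` avoiding x k n.+1 = \bigcup_z F z.
  apply/seteqP; split=> [w [hc ha]|w [z _]].
    exists (X k.+1 w) => //; rewrite /F ifN; last first.
      by apply/eqP; apply: ha; rewrite addnS !ltnS leqnn leq_addr.
    split=> i.
      by rewrite leq_eqVlt => /predU1P[->|ik]; rewrite ?vE// vk// hc.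
    by rewrite addSnnS => /andP[ki ik]; apply: ha; rewrite ik (ltn_trans _ ki).
  rewrite /F; case: eqP => // zx [hc ha]; split=> i.
    by move=> ik; rewrite -(vk z)// hc// (leq_trans ik).
  move=> /andP[]; rewrite leq_eqVlt => /predU1P[<- _|ki ik].
    by rewrite hc// vE.
  by apply: ha; rewrite ki addSnnS.
have mF z : measurable (F z).
  rewrite /F; case: ifP => // _.
  by apply: measurableI;
    [exact: measurable_cylinder|exact: measurable_avoiding].
rewrite measure_semi_bigcup//; last 2 first.
- apply/trivIsetP => y z _ _ yz; rewrite /F.
  case: ifP => _; first by rewrite set0I.
  case: ifP => _; first by rewrite setI0.
  apply/seteqP; split=> // w [[hy _] [hz _]]; move/eqP: yz; apply.
  by rewrite -(vE y) -(vE z) -(hy _ (leqnn _)) -(hz _ (leqnn _)).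
- exact: bigcupT_measurable.
have QF z : Q (F z) = Q (cylinder k u) *
    (amfc d p (u k) z * taboo x (avoid d p x n) z)%:E.
  rewrite /F /taboo; case: ifP => _; first by rewrite measure0 mulr0 mule0.
  rewrite IH vE EFinM muleA; congr (_ * _).
  rewrite /cylinder hQ vE vk//; congr (Q _ * _).
  by apply/seteqP; split=> w /= h i ik; have := h i ik; rewrite vk.
transitivity (\sum_(0 <= z <oo) (Q (cylinder k u) *
    (amfc d p (u k) z * taboo x (avoid d p x n) z)%:E)).
  by apply: eq_eseriesr => z _; exact: QF.
(* Only [z <= (u k).+1] can be reached, so the series is the finite sum defining [step]. *)
rewrite (@nneseries_finite _ (u k).+2); last first.
  by move=> z uz; rewrite amfc_eq0// mul0r mule0.
rewrite big_mkord -ge0_sume_distrr; last first.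
  move=> z _; rewrite lee_fin mulr_ge0 ?amfc_ge0//.
  by apply: taboo_ge0 => m; exact: avoid_ge0.
by rewrite sumEFin.
Qed.

(** * Return probability and return time *)

Definition no_return x n : set T := avoiding x 0 n.

Variable P : nat -> probability T R.
Hypothesis hX : markov_family P X (amfc d p).

Lemma no_returnE x n : P x (no_return x n) = (avoid d p x n x)%:E.
Proof.
have [start chain] := hX x.
have start' : P x (cylinder 0 (fun=> x)) = 1.
  rewrite -start; congr (P x _); apply/seteqP; split=> w /= h.
    exact: h.
  by move=> i; rewrite leqn0 => /eqP->.
have mC := measurable_cylinder 0 (fun=> x).
have mA := measurable_avoiding x 0 n.
have nC : P x (~` cylinder 0 (fun=> x)) = 0.
  by rewrite probability_setC// start' subee.
rewrite /no_return (measureDI _ mA mC)/= [avoiding _ _ _ `&` _]setIC.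
rewrite markov_avoiding// start' mul1e.
rewrite (@subset_measure0 _ _ _ _ _ (~` cylinder 0 (fun=> x))) ?add0e//.
- exact: measurableD.
- exact: measurableC.
Qed.

Lemma return_probE x : return_prob P X x =
  1 - P x (\bigcap_n no_return x n).
Proof.
have mN : measurable (\bigcap_n no_return x n).
  by apply: bigcap_measurableType => n _; exact: measurable_avoiding.
rewrite -probability_setC//; congr (P x _); apply/seteqP; split=> w /=.
  move=> [n [n1 nx]] h; apply: (h n I n _ nx).
  by rewrite n1 add0n leqnn.
move=> h; apply: contrapT => nr; apply: h => n _ i /andP[i1 _] ix.
by apply: nr; exists i.
Qed.

Lemma cvg_no_return x :
  (avoid d p x n x)%:E @[n --> \oo] --> P x (\bigcap_n no_return x n).
Proof.
have -> : (fun n => (avoid d p x n x)%:E) = P x \o no_return x.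
  by apply/funext => n; rewrite /= no_returnE.
apply: nonincreasing_cvg_mu.
- rewrite (le_lt_trans (probability_le1 _ _)) ?ltry//.
  exact: measurable_avoiding.
- by move=> n; exact: measurable_avoiding.
- by apply: bigcap_measurableType => n _; exact: measurable_avoiding.
- move=> m n mn; apply/subsetPset => w h i /andP[i1 im]; apply: h.
  by rewrite i1 (leq_trans im).
Qed.

Lemma measurable_return_time x :
  measurable_fun setT (return_time X x : T -> \bar R).
Proof.
(* The return time is a countable infimum of measurable functions; index [0] contributes [+oo], as
   returns count from time one. *)
pose g n m : \bar R := if (0 < n)%N && (m == x) then (n%:R)%:E else +oo.
have -> : return_time X x = (fun w => einfs (fun n => g n (X n w)) 0%N).
  apply/funext => w; rewrite /einfs/= /return_time; apply/eqP; rewrite eq_le.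
  apply/andP; split; apply: le_ereal_inf_tmp => _ [n /= hn <-].
    rewrite /g; case: ifPn => [/andP[n0 /eqP nx]|_]; last exact: leey.
    by apply: ereal_inf_lbound; exists n.
  case: hn => n0 nx; apply: ereal_inf_lbound; exists n => //.
  by rewrite /g n0 nx eqxx.
apply: measurable_fun_einfs => n; exact: measurableT_comp.
Qed.

(** A visit to [x] at time [m >= 1] rules out [no_return x n] for all [n >= m], so the sum is at
    most [minn N m]. *)
Lemma sum_no_return_le x N w :
  \sum_(0 <= n < N) (\1_(no_return x n) w : R)%:E <=
  (return_time X x w : \bar R).
Proof.
apply: le_ereal_inf_tmp => _ [m /= [m1 mx] <-].
rewrite sumEFin lee_fin.
apply: (@le_trans _ _ (\sum_(0 <= n < N) (n < m)%N%:R)%R).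
  apply: ler_sum => n _; rewrite indicE.
  case: (boolP (w \in _)) => //; rewrite inE => h; case: ltnP => // mn.
  by case: (h m) => //; rewrite m1.
suff -> : (\sum_(0 <= n < N) (n < m)%N%:R = (minn N m)%:R :> R)%R.
  by rewrite ler_nat geq_minr.
elim: N => [|N IH]; first by rewrite big_geq// min0n.
by rewrite big_nat_recr//= IH -natrD; congr _%:R; case: ltnP; lia.
Qed.

(** The half of the tail-sum formula for the mean that is enough to make it infinite. *)
Lemma integral_return_time_ge x N :
  (\sum_(0 <= n < N) avoid d p x n x)%:E <= \int[P x]_w return_time X x w.
Proof.
have -> : (\sum_(0 <= n < N) avoid d p x n x)%:E =
    \int[P x]_w \sum_(0 <= n < N) (\1_(no_return x n) w)%:E.
  rewrite ge0_integral_sum//.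
  - rewrite -sumEFin; apply: eq_bigr => n _.
    have mA : measurable (no_return x n) by exact: measurable_avoiding.
    by rewrite integral_indic// setIT; exact/esym/no_returnE.
  - move=> n; apply/measurable_EFinP; apply: measurable_indic.
    exact: measurable_avoiding.
apply: ge0_le_integral => //.
- by move=> w _; apply: sume_ge0 => n _; rewrite lee_fin.
- apply: emeasurable_sum => n; apply/measurable_EFinP; apply: measurable_indic.
  exact: measurable_avoiding.
- exact: measurable_return_time.
- by move=> w _; exact: sum_no_return_le.
Qed.

Lemma amfc_null_recurrent : infprod p = 0%R -> null_recurrent P X.
Proof.
move=> L0 x; split.
  rewrite return_probE; suff -> : P x (\bigcap_n no_return x n) = 0.
    by rewrite sube0.
  apply: cvg_unique (cvg_no_return (x := x)) _ => //.
  by apply: cvg_EFin; [exact: nearW|exact: cvg_avoid].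
apply/eqyP => B B0; have [N BN] := sum_avoid_unbounded d0 d_ge2 p01 x B L0.
by apply: le_trans (integral_return_time_ge x N); rewrite lee_fin.
Qed.

Lemma amfc_transient : infprod p <> 0%R -> transient P X.
Proof.
move=> L0 x; have L : (0 < infprod p)%R.
  by rewrite lt_neqAle infprod_ge0// andbT eq_sym; apply/eqP.
have [c c0 cn] := avoid_gt0_lb d0 d_ge2 p01 x L.
rewrite /transient_state return_probE.
rewrite lte_subel_addr// lteDl//.
apply: (@lt_le_trans _ _ c%:E); first by rewrite lte_fin.
rewrite -(cvg_lim _ (cvg_no_return (x := x)))//.
apply: lime_ge; first exact: cvgP (cvg_no_return (x := x)).
by apply: nearW => n; rewrite lee_fin.
Qed.

End PathLaw.

Theorem proposition2p1 (R : realType) (d : nat -> nat) (p : nat -> R)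
    (hd0 : d 0%N = 1%N)
    (hd : forall j : nat, (1 <= j)%N -> (2 <= d j)%N)
    (hp : forall j : nat, (1 <= j)%N -> 0 < p j <= 1)
    (disp : measure_display) (T : measurableType disp)
    (P : nat -> probability T R) (X : nat -> {mfun T >-> nat})
    (hX : markov_family P X (amfc d p)) :
  (null_recurrent P X <-> infprod p = 0) /\
  (infprod p <> 0 -> transient P X).
Proof.
have tr := @amfc_transient _ _ _ _ _ hd0 hd hp _ _ hX.
split=> //; split=> [nr|]; last exact: (amfc_null_recurrent hd0 hd hp hX).
(* State [0] would have return probability both equal to one and below one. *)
apply: contrapT => /tr/(_ 0%N); have [r1 _] := nr 0%N.
by rewrite /transient_state r1 ltxx.
Qed.
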